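(* Let $\mathcal X\subseteq\mathbb R$ be closed and convex, let $f\colon\mathcal X\to\mathbb R$ be convex and $L$-Lipschitz continuous on $\mathcal X$, and suppose that $\mathcal X_\star:=\arg\min_{x\in\mathcal X}f(x)\neq\emptyset$; put $f_\star:=\min_{x\in\mathcal X}f(x)\in\mathbb R$, $\Delta(x):=f(x)-f_\star$ and $\operatorname{dist}(x,\mathcal X_\star):=\inf_{z\in\mathcal X_\star}|x-z|$. Let $\eta>0$ and let $(X_k)_{k\ge1}$ be the iterates of the projected stochastic subgradient method on $(\mathcal X,f)$ with constant stepsize $\eta$, subgradients $(G_k)$ and noise $(W_k)$ (as defined in the context), started at a deterministic point $X_1\equiv x_1\in\mathcal X$. Suppose that the noise is given by a centered additive kernel oracle with parameter $\sigma>0$ which is both time-homogeneous and state-independent (as defined in the context). Then for every $n\ge2$ and every fixed stepsize $\eta>0$, $$\mathbb E[\Delta(X_n)]\le\frac{\operatorname{dist}(x_1,\mathcal X_\star)^2}{2\eta n}+\left((L+\sigma)^2+\frac{L^2+\sigma^2}{2}\right)\eta.$$ In particular, if $\eta=c_n/\sqrt n$ with $0<\underline c\le c_n\le\overline c<\infty$, then $$\mathbb E[\Delta(X_n)]\le\left[\frac{\operatorname{dist}(x_1,\mathcal X_\star)^2}{2\underline c}+\left((L+\sigma)^2+\frac{L^2+\sigma^2}{2}\right)\overline c\right]\cdot\frac1{\sqrt n}.$$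
   Context: Relative subgradients: for a convex set $\mathcal S\subseteq\mathbb R$, $x\in\mathcal S$ and convex $h\colon\mathcal S\to\mathbb R$, $\partial_{\mathcal S}h(x)$ is the set of $g\in\mathbb R$ with $h(y)\ge h(x)+g\cdot(y-x)$ for all $y\in\mathcal S$. $\Pi_{\mathcal X}(x):=\arg\min_{z\in\mathcal X}|x-z|$ is the projection onto $\mathcal X$. Projected stochastic subgradient method: given an $\mathcal X$-valued random variable $X_1$ and real random variables $(W_k)_{k\ge1}$, set $\mathcal F_1:=\sigma(X_1)$ and $\mathcal F_k:=\sigma(X_1,W_1,\dots,W_{k-1})$. For each $k\ge1$ let $G_k$ be an $\mathcal F_k$-measurable random variable with $G_k\in\partial_{\mathcal X}f(X_k)\cap[-L,L]$. Given $\eta>0$, the iterates are $$X_{k+1}:=\Pi_{\mathcal X}\bigl(X_k-\eta\,(G_k+W_k)\bigr),\qquad k\ge1.$$ Centered additive kernel oracle with parameter $\sigma>0$: there is a specified family of probability kernels $Q_k\colon\mathcal X\times\mathfrak B(\mathbb R)\to[0,1]$, $k\ge1$ (with $\mathfrak B$ denoting the Borel $\sigma$-field), such that for all $k\ge1$, $x\in\mathcal X$, $A\in\mathfrak B(\mathbb R)$: $\int_{\mathbb R}w\,Q_k(x,dw)=0$, $\int_{\mathbb R}w^2\,Q_k(x,dw)\le\sigma^2$, and $\mathbb P(W_k\in A\mid\mathcal F_k)=Q_k(X_k,A)$ a.s. Time-homogeneous: there is a probability kernel $Q$ with $Q_k(x,\cdot)=Q(x,\cdot)$ for all $k\ge1$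 and $x\in\mathcal X$. State-independent: for every $k\ge1$ there is a probability measure $\mu_k$ on $\mathbb R$ with $Q_k(x,\cdot)=\mu_k(\cdot)$ for all $x\in\mathcal X$. *)

(* Defs.v *)
From mathcomp Require Export all_boot all_order all_algebra.
From mathcomp Require Export all_classical all_reals all_analysis.
From mathcomp Require Export measurable_realfun.

Set Implicit Arguments.
Unset Strict Implicit.
Unset Printing Implicit Defensive.

Import Order.TTheory GRing.Theory Num.Theory.
Import numFieldNormedType.Exports.

Local Open Scope classical_set_scope.
Local Open Scope ring_scope.

(* A function on a subset D of the line is a total function R -> R of which
   only the values on D matter. *)

Definition argmin (R : realType) (D : set R) (h : R -> R) : set R :=
  [set x | D x /\ forall y, D y -> h x <= h y].

Definition min_value (R : realType) (D : set R) (h : R -> R) : R :=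
  inf [set h x | x in D].

Definition dist_set (R : realType) (x : R) (S : set R) : R :=
  inf [set `|x - z| | z in S].

(* The default value 0 is never used for D closed and nonempty; the minimiser
   is unique when D is moreover convex. *)
Definition proj (R : realType) (D : set R) (x : R) : R :=
  xget 0 (argmin D (fun z => `|x - z|)).

Definition subdifferential (R : realType) (D : set R) (h : R -> R) (x : R) :
    set R :=
  [set g | forall y, D y -> h x + g * (y - x) <= h y].

Definition measurable_wrt (T : Type) d (U : measurableType d)
    (F : set (set T)) (g : T -> U) : Prop :=
  forall A, measurable A -> F (g @^-1` A).

(* sigma(X1, W_1, ..., W_(k-1)), for 1 <= k. *)
Definition filtration (R : realType) (T : Type) (X1 : T -> R)
    (W : nat -> T -> R) (k : nat) : set (set T) :=
  <<s preimage_set_system setT X1 measurable `|`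
      \bigcup_(i in [set i | (0 < i < k)%N])
         preimage_set_system setT (W i) measurable >>.

(* Y is a version of the conditional probability P(E | F). *)
Definition is_cond_prob d (T : measurableType d) (R : realType)
    (P : probability T R) (F : set (set T)) (E : set T) (Y : T -> R) :
    Prop :=
  [/\ measurable_wrt F Y,
      P.-integrable setT (EFin \o Y) &
      forall B, F B -> (\int[P]_(w in B) (Y w)%:E)%E = P (E `&` B)].

(* Time is counted from 1: the values at index 0 of X, G, W and Q below are
   irrelevant. *)
Record subgradient_method d (T : measurableType d) (R : realType)
    (P : probability T R) (D : set R) (f : R -> R) (L eta : R)
    (X G : nat -> T -> R) (W : nat -> {RV P >-> R}) : Prop :=
  SubgradientMethod {
    init_measurable : measurable_fun setT (X 1%N) ;
    init_in : forall w, D (X 1%N w) ;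
    subgrad_measurable : forall k, (0 < k)%N ->
      measurable_wrt (filtration (X 1%N) W k) (G k) ;
    subgrad_in : forall k w, (0 < k)%N ->
      (subdifferential D f (X k w) `&` `[- L, L]) (G k w) ;
    iterate_step : forall k w, (0 < k)%N ->
      X k.+1 w = proj D (X k w - eta * (G k w + W k w)) }.

(* The kernels live on the whole line and are only used at points of D; as D
   is Borel, every kernel from D to R is the restriction of such a kernel.
   The second moment bound makes the mean a convergent integral. *)
Record kernel_oracle d (T : measurableType d) (R : realType)
    (P : probability T R) (D : set R) (sigma : R)
    (X : nat -> T -> R) (W : nat -> {RV P >-> R})
    (Q : nat -> R.-pker R ~> R) : Prop :=
  KernelOracle {
    oracle_centered : forall k x, (0 < k)%N -> D x ->
      (\int[Q k x]_w w%:E = 0)%E ;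
    oracle_second_moment : forall k x, (0 < k)%N -> D x ->
      (\int[Q k x]_w (w ^+ 2)%:E <= (sigma ^+ 2)%:E)%E ;
    oracle_cond_law : forall k A, (0 < k)%N -> measurable A ->
      exists2 Y, is_cond_prob P (filtration (X 1%N) W k) (W k @^-1` A) Y &
        {ae P, forall w, (Y w)%:E = Q k (X k w) A} }.

Definition time_homogeneous (R : realType) (D : set R)
    (Q : nat -> R.-pker R ~> R) : Prop :=
  exists Q0 : R.-pker R ~> R, forall k x A, (0 < k)%N -> D x ->
    measurable A -> Q k x A = Q0 x A.

Definition state_independent (R : realType) (D : set R)
    (Q : nat -> R.-pker R ~> R) : Prop :=
  forall k, (0 < k)%N -> exists mu : probability R R,
    forall x A, D x -> measurable A -> Q k x A = mu A.

(* Main.v *)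
From HB Require Import structures.
Require Import Defs.
From mathcomp Require Import ring lra.
Import Order.TTheory GRing.Theory Num.Theory.
Import numFieldNormedType.Exports.

Set Implicit Arguments.
Unset Strict Implicit.
Unset Printing Implicit Defensive.

Local Open Scope classical_set_scope.
Local Open Scope ring_scope.

(** The proof compares each side of a minimiser with a monotone reflected walk
    driven by the same noise.

    Fix a minimiser [xs].  In the signed distance [z = s * (x - xs)], with
    [s = 1] or [s = -1], the gap [f x - f xs] is the sum over the two signs of
    nondecreasing [L]-Lipschitz functions [side_gap], so one side can be studied
    at a time.  The map [y |-> y - eta * g y] of a subgradient step is not
    monotone, because the subgradient may jump, but its upper monotone envelope
    [drift] is.  A subgradient step from the wrong side of [xs], or from [xs]
    itself, ends at distance at most [b = eta * L] on the studied side; so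
    [drift] is taken with floor [b].  The operators
      [K_x psi z = E psi (max x (drift z - zeta * W))],  [x >= b],
    act on nondecreasing functions and are nondecreasing in the barrier [x].
    Because the noise is independent of the past with a fixed law, they dominate
    the iterates: [E psi (X_n) <= K_b^(n-1) psi (x_1)] ([integral_iter_le]),
    although the subgradients may depend on the whole past.

    Let [psi_x] be the excess of the one-sided gap over its value at [x].  Two
    consequences of the same quadratic Lyapunov inequality ([drift_loss],
    [reflected_op_drift]) give the rate.
    - With the classical weight [1 / (2 * eta)], the average of
      [K_b^j psi_b z] over [j < n] is at most
      [z^2 / (2 * eta * n) + eta * (L^2 + sigma^2) / 2].
    - A walk started at its barrier increases stochastically with time, since
      after one step it can only be further out.  So [K_x^j psi_x x] is at most
      its long-run average, which a heavier weight bounds by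
      [e = eta * (sigma^2 / 2 + L * sigma)].
    As raising the barrier to the starting point raises the walk, the second
    point yields [K_b^r psi_b <= psi_b + e] for every [r]
    ([iter_op_excess_le]): from any point, the expected excess never exceeds its
    initial value by more than [e].  Hence the last value of [K_b^j psi_b z] is
    at most the average plus [e] ([iter_op_excess_last]).

    Finally the gap is at most [L * b] plus the excesses on the two sides, and
    [L * b] is paid only once.  The side of [x_1] contributes the average bound
    plus [e]; on the other side the starting excess is zero, so that side
    contributes [e].  The sum
      [eta * L^2 + eta * (L^2 + sigma^2) / 2 + 2 * e]
    is the announced constant times [eta]. *)

(** * Reflected Markov operators on nondecreasing functions *)

Definition nng_nondecreasing (R : realType) (psi : R -> \bar R) : Prop :=
  (forall z, 0 <= psi z)%E /\ (forall y z, y <= z -> (psi y <= psi z)%E).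

Lemma nng_nondecreasing_measurable (R : realType) (psi : R -> \bar R) :
  nng_nondecreasing psi -> measurable_fun setT psi.
Proof.
move=> [_ psi_nd].
apply: (measurability _ (ErealGenCInfty.measurableE R)) => _ /= [_ [r ->] <-].
rewrite setTI; apply: is_interval_measurable => s t /=.
rewrite !in_itv/= !andbT => ys yt u /andP[su ut].
by rewrite in_itv/= andbT (le_trans ys)// psi_nd.
Qed.

Lemma integral_probability_cst d (T : measurableType d) (R : realType)
  (P : probability T R) (c : \bar R) : (\int[P]_w c = c)%E.
Proof.
rewrite [LHS](_ : _ = \int[P]_w cst c w)%E// integral_cst// -[RHS]mule1.
by congr (_ * _)%E; exact: probability_setT.
Qed.

Section reflected_operator.
Context (R : realType) (mu : probability R R) (zeta : R) (M : R -> R).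
Hypothesis M_nd : {homo M : y z / y <= z}.
Implicit Types (x z : R) (psi : R -> \bar R).

(** The transition operator of the walk [z |-> max x (M z - zeta * w)].  It is
    extended-real valued, so that nonnegative functions need no integrability. *)
Definition reflected_op x psi z : \bar R :=
  (\int[mu]_w psi (Num.max x (M z - zeta * w))%R)%E.

Lemma measurable_reflected_step x z :
  measurable_fun setT (fun w : R => Num.max x (M z - zeta * w)).
Proof.
by apply: measurable_maxr => //; apply: measurable_funB.
Qed.

Lemma measurable_reflected_comp x z psi : nng_nondecreasing psi ->
  measurable_fun setT (fun w : R => psi (Num.max x (M z - zeta * w))%R).
Proof.
move=> Hpsi; apply: (measurableT_comp (nng_nondecreasing_measurable Hpsi)).
exact: measurable_reflected_step.
Qed.

Lemma reflected_op_le x x' z z' psi psi' :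
  nng_nondecreasing psi -> nng_nondecreasing psi' ->
  x <= x' -> z <= z' -> (forall y, psi y <= psi' y)%E ->
  (reflected_op x psi z <= reflected_op x' psi' z')%E.
Proof.
move=> Hpsi Hpsi' xx' zz' le_psi; apply: ge0_le_integral => //.
- by move=> w _; exact: Hpsi.1.
- exact: measurable_reflected_comp.
- exact: measurable_reflected_comp.
move=> w _; apply: (le_trans (le_psi _)); apply: Hpsi'.2.
by rewrite ge_max !le_max xx' lerD2r M_nd ?orbT.
Qed.

Lemma reflected_op_nng_nondecreasing x psi :
  nng_nondecreasing psi -> nng_nondecreasing (reflected_op x psi).
Proof.
move=> Hpsi; split=> [z|y z yz]; last exact: reflected_op_le.
by apply: integral_ge0 => w _; exact: Hpsi.1.
Qed.

Lemma reflected_opD x psi psi' z :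
  nng_nondecreasing psi -> nng_nondecreasing psi' ->
  reflected_op x (fun y => psi y + psi' y)%E z =
  (reflected_op x psi z + reflected_op x psi' z)%E.
Proof.
move=> Hpsi Hpsi'; apply: ge0_integralD => //.
- by move=> w _; exact: Hpsi.1.
- exact: measurable_reflected_comp.
- by move=> w _; exact: Hpsi'.1.
- exact: measurable_reflected_comp.
Qed.

Lemma reflected_op_cst x (c : \bar R) z : reflected_op x (cst c) z = c.
Proof. exact: integral_probability_cst. Qed.

Lemma iter_op_nng_nondecreasing x psi j :
  nng_nondecreasing psi -> nng_nondecreasing (iter j (reflected_op x) psi).
Proof.
by move=> Hpsi; elim: j => //= j IH; exact: reflected_op_nng_nondecreasing.
Qed.

Lemma iter_op_le x x' psi psi' j z z' :
  nng_nondecreasing psi -> nng_nondecreasing psi' ->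
  x <= x' -> z <= z' -> (forall y, psi y <= psi' y)%E ->
  (iter j (reflected_op x) psi z <= iter j (reflected_op x') psi' z')%E.
Proof.
move=> Hpsi Hpsi' xx' + le_psi; elim: j z z' => [|j IH] z z' zz' /=.
  exact: le_trans (Hpsi.2 _ _ zz') _.
apply: reflected_op_le => //; [exact: iter_op_nng_nondecreasing..|].
by move=> y; exact: IH.
Qed.

Lemma iter_opD_cst x psi (c : R) j z : nng_nondecreasing psi -> 0 <= c ->
  iter j (reflected_op x) (fun y => psi y + c%:E)%E z =
  (iter j (reflected_op x) psi z + c%:E)%E.
Proof.
move=> Hpsi c0; elim: j z => //= j IH z.
rewrite (_ : iter j _ _ = fun y => iter j (reflected_op x) psi y + cst c%:E y)%E;
  last by apply/funext => y; rewrite IH.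
rewrite reflected_opD ?reflected_op_cst//.
exact: iter_op_nng_nondecreasing.
Qed.

Lemma sum_nng_nondecreasing (F : nat -> R -> \bar R) N :
  (forall j, nng_nondecreasing (F j)) ->
  nng_nondecreasing (fun z => \sum_(j < N) F j z)%E.
Proof.
move=> HF; split=> [z|y z yz]; first by apply: sume_ge0 => j _; exact: (HF j).1.
by apply: lee_sum => j _; exact: (HF j).2.
Qed.

Lemma reflected_op_sum x (F : nat -> R -> \bar R) N z :
  (forall j, nng_nondecreasing (F j)) ->
  reflected_op x (fun y => \sum_(j < N) F j y)%E z =
  (\sum_(j < N) reflected_op x (F j) z)%E.
Proof.
move=> HF; elim: N => [|N IH].
  by under eq_fun do rewrite big_ord0; rewrite big_ord0 reflected_op_cst.
under eq_fun do rewrite big_ord_recr /=.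
by rewrite big_ord_recr /= -IH reflected_opD//; exact: sum_nng_nondecreasing.
Qed.

(** Summing the drift inequality along the walk: each application of the operator
    trades one unit of [V] for one value of [psi], at cost [a]. *)
Lemma sum_iter_op_le x psi V (a : R) N z :
  nng_nondecreasing psi -> nng_nondecreasing V -> 0 <= a ->
  (forall y, reflected_op x V y + psi y <= V y + a%:E)%E ->
  (\sum_(j < N) iter j (reflected_op x) psi z <= V z + (N%:R * a)%:E)%E.
Proof.
move=> Hpsi HV a0 drift; elim: N z => [|N IH] z.
  by rewrite big_ord0 mul0r adde0; exact: HV.1.
rewrite big_ord_recl /=.
have Hiter j := iter_op_nng_nondecreasing x j Hpsi.
rewrite -(reflected_op_sum _ _ _ Hiter).
have Na0 : 0 <= N%:R * a by rewrite mulr_ge0.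
have HVN : nng_nondecreasing (fun y => V y + cst (N%:R * a)%:E y)%E.
  split=> [y|y y' yy']; first by rewrite adde_ge0 ?lee_fin//; exact: HV.1.
  by rewrite leeD2r//; exact: HV.2.
have : (reflected_op x (fun y => \sum_(j < N) iter j (reflected_op x) psi y) z
    <= reflected_op x V z + (N%:R * a)%:E)%E.
  rewrite -[X in (_ + X)%E](reflected_op_cst x _ z) -reflected_opD//.
  by apply: reflected_op_le => //; exact: sum_nng_nondecreasing Hiter.
move=> /(leeD2l (psi z)) /le_trans; apply.
rewrite addeA [X in (X + _)%E]addeC (le_trans (leeD2r _ (drift z)))//.
by rewrite -addeA -EFinD -natr1 mulrDl mul1r [a + _]addrC.
Qed.

(** A walk at its barrier can only move out, and monotonicity propagates that
    first move to all later times. *)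
Lemma iter_op_boundary_nd x psi i j : nng_nondecreasing psi -> (i <= j)%N ->
  (iter i (reflected_op x) psi x <= iter j (reflected_op x) psi x)%E.
Proof.
move=> Hpsi; elim: j => [|j IH]; first by rewrite leqn0 => /eqP ->.
rewrite leq_eqVlt => /predU1P[->//|/IH le_ij].
apply: (le_trans le_ij) => {le_ij IH} /=.
have Hj := iter_op_nng_nondecreasing x j Hpsi.
set Fj := iter j _ psi in Hj *.
rewrite -[leLHS](reflected_op_cst x _ x); apply: ge0_le_integral => //.
- by move=> w _; exact: Hj.1.
- exact: measurable_reflected_comp.
- by move=> w _; apply: Hj.2; rewrite le_max lexx.
Qed.

(** The values at the barrier are nondecreasing in time, hence bounded by their
    long-run averages, in which the initial potential [V x] disappears; this
    turns an averaged bound into a bound at every single time. *)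
Lemma iter_op_boundary_le x psi V (a : R) r :
  nng_nondecreasing psi -> nng_nondecreasing V -> 0 <= a -> V x = 0%E ->
  (forall y, reflected_op x V y + psi y <= V y + a%:E)%E ->
  (iter r (reflected_op x) psi x <= a%:E)%E.
Proof.
move=> Hpsi HV a0 Vx0 drift.
have bound N :
    (N%:R%:E * iter r (reflected_op x) psi x <= ((r + N)%:R * a)%:E)%E.
  have := sum_iter_op_le (r + N) x Hpsi HV a0 drift.
  rewrite Vx0 add0e; apply: le_trans.
  rewrite big_split_ord /= (le_trans _ (leeDr _ _))//; last first.
    by apply: sume_ge0 => j _; exact: (iter_op_nng_nondecreasing _ _ Hpsi).1.
  rewrite mule_natl.
  have -> : (iter r (reflected_op x) psi x *+ N =
      \sum_(j < N) iter r (reflected_op x) psi x)%E.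
    by rewrite sumr_const card_ord.
  by apply: lee_sum => j _; apply: iter_op_boundary_nd => //; rewrite leq_addr.
have := (iter_op_nng_nondecreasing x r Hpsi).1 x.
move: bound; case: (iter r _ psi x) => [t| |//] bound _; last first.
  by have := bound 1%N; rewrite mul1e leye_eq.
rewrite lee_fin leNgt; apply/negP => at_.
have ta0 : 0 < t - a by rewrite subr_gt0.
have := bound (Num.bound (r%:R * a / (t - a))).
set N := Num.bound _.
have : r%:R * a / (t - a) < N%:R.
  by apply: archi_boundP; rewrite divr_ge0 ?mulr_ge0// ltW.
rewrite ltr_pdivrMr// => ltN; rewrite lee_fin natrD; lra.
Qed.

End reflected_operator.

(** * The monotone envelope of the subgradient step *)

Definition excess (R : realType) (phi : R -> R) (x z : R) : R :=
  Num.max 0 (phi z - phi x).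

Definition sqdist_right (R : realType) (x z : R) : R := Num.max 0 (z - x) ^+ 2.

Section drift_envelope.
Context (R : realType) (phi : R -> R) (L eta b : R).
Hypothesis eta_gt0 : 0 < eta.
Implicit Types (u x y z g : R).

(** The only part of the subgradient inequality at [y] that the walk uses: it is
    tested against points between the floor [b] and [y]. *)
Definition right_slope y g : Prop :=
  0 <= g <= L /\ forall x, b <= x <= y -> phi y - phi x <= g * (y - x).

(** The positions after a subgradient step from the left of [z]; their supremum
    is the least monotone majorant, with floor [b], of the possibly non-monotone
    subgradient step. *)
Definition drift_set z : set R :=
  [set u | u = b \/
    exists y g, [/\ y <= z, right_slope y g & u = y - eta * g]].

Definition drift z : R := sup (drift_set z).

Lemma drift_set_ub z u : drift_set z u -> u <= Num.max b z.
Proof.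
rewrite le_max => -[->|[y [g [yz [/andP[g0 _] _] ->]]]]; first by rewrite lexx.
by apply/orP; right; rewrite lerBlDr (le_trans yz)// lerDl mulr_ge0// ltW.
Qed.

Lemma drift_ub z u : drift_set z u -> u <= drift z.
Proof.
move=> zu; apply: ub_le_sup => //; exists (Num.max b z) => v; exact: drift_set_ub.
Qed.

Lemma drift_le z c : (forall u, drift_set z u -> u <= c) -> drift z <= c.
Proof. by move=> le_c; apply: ge_sup => //; exists b; left. Qed.

Lemma drift_le_max z : drift z <= Num.max b z.
Proof. by apply: drift_le => u; exact: drift_set_ub. Qed.

Lemma drift_nd : {homo drift : y z / y <= z}.
Proof.
move=> y z yz; apply: drift_le => u [->|[y' [g [y'y gy' ->]]]]; apply: drift_ub.
  by left.
by right; exists y', g; split => //; exact: le_trans yz.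
Qed.

Hypothesis phi_nd : {homo phi : y z / y <= z}.
Hypothesis phi_lip : forall y z, y <= z -> phi z - phi y <= L * (z - y).

(** With [t] the distance to the barrier after the step from [y], [g] the slope
    at [y] and [delta] the distance [z - y], the left-hand side bounds the excess at
    [z] and the bracket is the loss of squared distance from [z] to [t].  Which
    weights [kappa] are possible is thus a question on three numbers. *)
Definition loss_pair (kappa c : R) : Prop :=
  0 < kappa /\ forall g t delta : R, 0 <= g <= L -> 0 <= t -> 0 <= delta ->
    g * (t + eta * g) + L * delta <=
    kappa * ((t + eta * g + delta) ^+ 2 - t ^+ 2) + c.

Lemma loss_pair_ge0 kappa c : 0 <= L -> loss_pair kappa c -> 0 <= c.
Proof.
move=> L0 [_ /(_ 0 0 0)]; rewrite !lexx L0 => /(_ isT isT isT).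
by rewrite !(mulr0, addr0, expr0n, subr0, add0r).
Qed.

(** The supremum [drift z] need not be attained at [z], which is why the excess
    at [z] is split at [y] into a subgradient part up to [y] and a Lipschitz part
    from [y] to [z]. *)
Lemma drift_loss kappa c x z : 0 <= L -> b <= x -> loss_pair kappa c ->
  kappa * sqdist_right x (drift z) + excess phi x z <=
  kappa * sqdist_right x z + c.
Proof.
move=> L0 bx Hkc; have c0 := loss_pair_ge0 L0 Hkc.
have [k0 pair_le] := Hkc.
have [zx|xz] := leP z x.
  have dx : drift z <= x.
    by apply: (le_trans (drift_le_max z)); rewrite ge_max bx.
  rewrite /excess /sqdist_right !(max_idPl _) ?subr_le0//; last exact: phi_nd.
  by rewrite expr0n !mulr0 !add0r.
set s := z - x; have s0 : 0 <= s by rewrite subr_ge0 ltW.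
have exE : excess phi x z = phi z - phi x.
  by apply/max_idPr; rewrite subr_ge0 phi_nd// ltW.
have dE : sqdist_right x z = s ^+ 2 by rewrite /sqdist_right (max_idPr s0).
have far : phi z - phi x <= kappa * s ^+ 2 + c.
  have := pair_le 0 0 s; rewrite lexx L0 => /(_ isT isT s0).
  rewrite !(mulr0, addr0, expr0n, subr0, add0r); apply: le_trans.
  by apply: phi_lip; rewrite ltW.
rewrite exE dE.
(* The squared distance to the barrier that a single step may reach. *)
pose B := (kappa * s ^+ 2 + c - (phi z - phi x)) / kappa.
have B0 : 0 <= B by rewrite divr_ge0 ?subr_ge0// ltW.
suff : sqdist_right x (drift z) <= B by rewrite /B ler_pdivlMr// => ?; lra.
suff dB : drift z <= x + Num.sqrt B.
  rewrite /sqdist_right -[leRHS]sqr_sqrtr// ler_sqr ?nnegrE ?sqrtr_ge0//.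
    by rewrite ge_max sqrtr_ge0 lerBlDl.
  by rewrite le_max lexx.
apply: drift_le => u zu; have [ux|xu] := leP u x.
  by rewrite (le_trans ux)// lerDl sqrtr_ge0.
case: zu xu => [->|[y [g [yz [/andP[g0 gL] slope] ->]]] xu].
  by rewrite ltNge bx.
have xy : x <= y by rewrite (le_trans (ltW xu))// gerBl mulr_ge0// ltW.
rewrite -lerBlDl -[leLHS]gtr0_norm ?subr_gt0// -sqrtr_sqr ler_wsqrtr//.
rewrite /B ler_pdivlMr//.
have := pair_le g (y - eta * g - x) (z - y); rewrite g0 gL subr_ge0 ltW//.
rewrite subr_ge0 yz => /(_ isT isT isT).
have := phi_lip yz; have := slope x; rewrite bx xy => /(_ isT).
rewrite /s.
have -> : y - eta * g - x + eta * g = y - x by ring.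
have -> : y - x + (z - y) = z - x by ring.
lra.
Qed.

(** The classical weight of the subgradient method; its error [eta * L^2 / 2] does
    not vanish with the noise. *)
Lemma loss_pair_regret : 0 <= L -> loss_pair (1 / (2 * eta)) (eta * L ^+ 2 / 2).
Proof.
move=> L0; split; first by rewrite divr_gt0// mulr_gt0.
move=> g t delta /andP[g0 gL] t0 d0.
set u : R := delta / eta; have -> : delta = eta * u by rewrite /u mulrC divfK// gt_eqF.
have u0 : 0 <= u by rewrite divr_ge0// ltW.
rewrite -subr_ge0.
have -> : 1 / (2 * eta) * ((t + eta * g + eta * u) ^+ 2 - t ^+ 2) +
    eta * L ^+ 2 / 2 - (g * (t + eta * g) + L * (eta * u)) =
    t * u + eta / 2 * ((u - (L - g)) ^+ 2 + 2 * (g * (L - g))).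
  by field; rewrite gt_eqF.
have gLg : 0 <= g * (L - g) by rewrite mulr_ge0// subr_ge0.
have e2 : 0 <= eta / 2 by rewrite divr_ge0// ltW.
rewrite addr_ge0 ?(mulr_ge0 t0 u0)// (mulr_ge0 e2)// addr_ge0 ?sqr_ge0//.
by rewrite mulr_ge0.
Qed.

(** A heavier weight lowers the error to order [L * sigma].  The extra weight
    [L / (2 * eta * sigma)] is the one for which the inequality of arithmetic and
    geometric means absorbs the linear terms: it leaves the square of
    [g + delta / eta - sigma]. *)
Lemma loss_pair_boundary (sigma : R) : 0 <= L -> 0 < sigma ->
  loss_pair (1 / (2 * eta) + L / (2 * eta * sigma)) (eta * L * sigma / 2).
Proof.
move=> L0 s0; split.
  by rewrite ltr_wpDr ?divr_ge0 ?divr_gt0 ?mulr_ge0 ?mulr_gt0// ltW.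
move=> g t delta /andP[g0 gL] t0 d0.
set u : R := delta / eta; have -> : delta = eta * u by rewrite /u mulrC divfK// gt_eqF.
have u0 : 0 <= u by rewrite divr_ge0// ltW.
rewrite -subr_ge0.
have -> : (1 / (2 * eta) + L / (2 * eta * sigma)) *
      ((t + eta * g + eta * u) ^+ 2 - t ^+ 2) +
    eta * L * sigma / 2 - (g * (t + eta * g) + L * (eta * u)) =
    t * u + (L / sigma) * t * (g + u) + eta / 2 * (u ^+ 2 + 2 * (g * u)) +
    eta / (2 * sigma) * (L * (g + u - sigma) ^+ 2) + eta / 2 * (g * (2 * L - g)).
  by field; rewrite !gt_eqF.
have Lg : 0 <= 2 * L - g by lra.
have e2 : 0 <= eta / 2 by rewrite divr_ge0// ltW.
have Ls : 0 <= L / sigma by rewrite divr_ge0// ltW.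
have es : 0 <= eta / (2 * sigma) by rewrite divr_ge0 ?mulr_ge0// ltW.
have tu : 0 <= t * u by rewrite mulr_ge0.
have gu : 0 <= g * u by rewrite mulr_ge0.
rewrite !addr_ge0//.
- by rewrite (mulr_ge0 (mulr_ge0 Ls t0))// addr_ge0.
- by rewrite (mulr_ge0 e2)// addr_ge0 ?sqr_ge0 ?(mulr_ge0 _ gu).
- by rewrite (mulr_ge0 es)// mulr_ge0 ?sqr_ge0.
- by rewrite (mulr_ge0 e2)// mulr_ge0.
Qed.

End drift_envelope.

(** * Lyapunov estimates for the reflected walk *)

Section centered_noise.
Context (R : realType) (mu : probability R R) (sigma : R).
Hypothesis mu_centered : (\int[mu]_w w%:E = 0)%E.
Hypothesis mu_moment2 : (\int[mu]_w (w ^+ 2)%:E <= (sigma ^+ 2)%:E)%E.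

Lemma integrable_sqr : mu.-integrable setT (fun w : R => (w ^+ 2)%:E).
Proof.
apply/integrableP; split; first by apply/measurable_EFinP; exact: measurable_funX.
under eq_integral do rewrite gee0_abs ?lee_fin ?sqr_ge0//.
exact: le_lt_trans mu_moment2 (ltry _).
Qed.

Lemma integrable_cst_real (c : R) : mu.-integrable setT (fun _ : R => c%:E).
Proof. exact: finite_measure_integrable_cst. Qed.

Lemma integrable_id : mu.-integrable setT (fun w : R => w%:E).
Proof.
apply: (@le_integrable _ _ _ mu setT _ _ (fun w : R => (1 + w ^+ 2)%:E)) => //.
- by apply/measurable_EFinP.
- move=> w _; rewrite !abse_EFin lee_fin.
  have := sqr_ge0 (`|w| - 1); rewrite [`|1 + _|]ger0_norm; last first.
    by rewrite addr_ge0// sqr_ge0.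
  rewrite -[w ^+ 2]real_normK ?num_real//; have := normr_ge0 w; nra.
- have -> : (fun w : R => (1 + w ^+ 2)%:E) =
      ((fun w : R => 1%:E) \+ (fun w : R => (w ^+ 2)%:E))%E by [].
  by apply: integrableD => //; [exact: integrable_cst_real|exact: integrable_sqr].
Qed.

Lemma integral_sqr_shift_le (a zeta : R) :
  (\int[mu]_w ((a - zeta * w) ^+ 2)%:E <= (a ^+ 2 + zeta ^+ 2 * sigma ^+ 2)%:E)%E.
Proof.
have -> : (\int[mu]_w ((a - zeta * w) ^+ 2)%:E =
   \int[mu]_w (((a ^+ 2)%:E + (zeta ^+ 2)%:E * (w ^+ 2)%:E)
               + (- (2 * a * zeta))%:E * w%:E))%E.
  apply: eq_integral => w _; rewrite -!EFinM -!EFinD; congr EFin; ring.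
have iw2 : mu.-integrable setT (fun w : R => (zeta ^+ 2)%:E * (w ^+ 2)%:E)%E.
  by apply: integrableZl => //; exact: integrable_sqr.
have ia := integrable_cst_real (a ^+ 2).
rewrite integralD//=; [|exact: integrableD|]; last first.
  by apply: integrableZl => //; exact: integrable_id.
rewrite integralD//= !integralZl//=; [|exact: integrable_id|exact: integrable_sqr].
rewrite mu_centered mule0 adde0 EFinD leeD//.
  by rewrite integral_probability_cst.
by rewrite [leRHS]EFinM lee_wpmul2l ?lee_fin ?sqr_ge0.
Qed.

End centered_noise.

Section one_sided_walk.
Context (R : realType) (mu : probability R R) (sigma : R).
Hypothesis sigma_gt0 : 0 < sigma.
Hypothesis mu_centered : (\int[mu]_w w%:E = 0)%E.
Hypothesis mu_moment2 : (\int[mu]_w (w ^+ 2)%:E <= (sigma ^+ 2)%:E)%E.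
Context (phi : R -> R) (L eta b zeta : R).
Hypothesis eta_gt0 : 0 < eta.
Hypothesis L_ge0 : 0 <= L.
Hypothesis zeta_sqr : zeta ^+ 2 = eta ^+ 2.
Hypothesis phi_nd : {homo phi : y z / y <= z}.
Hypothesis phi_lip : forall y z, y <= z -> phi z - phi y <= L * (z - y).

Let M := drift phi L eta b.
Let M_nd : {homo M : y z / y <= z} := @drift_nd _ phi L eta b eta_gt0.
Let K := reflected_op mu zeta M.
Let exc x (z : R) : \bar R := (excess phi x z)%:E.

Lemma excess_nng_nondecreasing x : nng_nondecreasing (exc x).
Proof.
split=> [z|y z yz]; first by rewrite lee_fin /excess le_max lexx.
by rewrite lee_fin /excess ge_max !le_max lexx/= lerD2r phi_nd// orbT.
Qed.

Lemma sqdist_nng_nondecreasing (kappa x : R) : 0 <= kappa ->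
  nng_nondecreasing (fun z : R => (kappa * sqdist_right x z)%:E).
Proof.
move=> k0; split=> [z|y z yz]; rewrite lee_fin; first by rewrite mulr_ge0// sqr_ge0.
have max0 (t : R) : 0 <= Num.max 0 t by rewrite le_max lexx.
rewrite ler_wpM2l// /sqdist_right ler_sqr ?nnegrE//.
by rewrite ge_max !le_max lexx/= lerD2r yz orbT.
Qed.

(** Clipping at the barrier only decreases the distance to it, so centred noise
    adds at most its variance. *)
Lemma reflected_op_sqdist_le (kappa x z : R) : 0 <= kappa ->
  (K x (fun y => (kappa * sqdist_right x y)%:E) z <=
   (kappa * sqdist_right x (M z) + kappa * (eta ^+ 2 * sigma ^+ 2))%:E)%E.
Proof.
move=> k0; set m := Num.max 0 (M z - x).
have step : (K x (fun y => (kappa * sqdist_right x y)%:E) z <=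
    \int[mu]_w (kappa%:E * ((m - zeta * w) ^+ 2)%:E))%E.
  apply: ge0_le_integral => //.
  - by move=> w _; rewrite lee_fin mulr_ge0// sqr_ge0.
  - exact: (@measurable_reflected_comp _ zeta M x z _ (sqdist_nng_nondecreasing x k0)).
  - apply: measurable_funeM; apply/measurable_EFinP; apply: measurable_funX.
    by apply: measurable_funB.
  move=> w _; rewrite -EFinM lee_fin ler_wpM2l// /sqdist_right.
  have [h|h] := leP (Num.max x (M z - zeta * w) - x) 0.
    by rewrite expr0n sqr_ge0.
  have mM : M z - x <= m by rewrite /m le_max lexx orbT.
  rewrite ler_sqr ?nnegrE//; last 2 first.
  - exact: ltW.
  - move: h; rewrite subr_gt0 lt_max ltxx/=; lra.
  move: h; rewrite subr_gt0 lt_max ltxx/= => h.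
  by rewrite (max_idPr (ltW h)); lra.
apply: (le_trans step); rewrite ge0_integralZl_EFin//; last first.
- apply/measurable_EFinP; apply: measurable_funX; exact: measurable_funB.
- by move=> w _; rewrite lee_fin sqr_ge0.
rewrite -mulrDr EFinM lee_wpmul2l//.
by rewrite -zeta_sqr; exact: integral_sqr_shift_le.
Qed.

Lemma reflected_op_drift (kappa c x z : R) : b <= x -> loss_pair L eta kappa c ->
  (K x (fun y => (kappa * sqdist_right x y)%:E) z + exc x z <=
   (kappa * sqdist_right x z)%:E + (c + kappa * (eta ^+ 2 * sigma ^+ 2))%:E)%E.
Proof.
move=> bx Hkc; have k0 := ltW Hkc.1.
apply: (le_trans (leeD2r _ (reflected_op_sqdist_le _ _ k0))).
rewrite -!EFinD lee_fin.
by have := drift_loss eta_gt0 phi_nd phi_lip z L_ge0 bx Hkc; rewrite -/M; lra.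
Qed.

(** Bounds the mean excess of a walk over its starting point when it is reflected
    there. *)
Definition boundary_cost : R := eta * (sigma ^+ 2 / 2 + L * sigma).

Lemma boundary_cost_ge0 : 0 <= boundary_cost.
Proof.
by rewrite mulr_ge0 ?addr_ge0 ?divr_ge0 ?sqr_ge0 ?mulr_ge0// ltW.
Qed.

Lemma iter_op_excess_boundary x r : b <= x ->
  (iter r (K x) (exc x) x <= boundary_cost%:E)%E.
Proof.
move=> bx; have Hkc := loss_pair_boundary eta_gt0 L_ge0 sigma_gt0.
apply: (iter_op_boundary_le M_nd _ (excess_nng_nondecreasing x)
  (sqdist_nng_nondecreasing x (ltW Hkc.1))).
- exact: boundary_cost_ge0.
- by rewrite /sqdist_right subrr maxxx expr0n mulr0.
move=> y; have := reflected_op_drift y bx Hkc.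
suff -> : eta * L * sigma / 2 + (1 / (2 * eta) + L / (2 * eta * sigma)) *
  (eta ^+ 2 * sigma ^+ 2) = boundary_cost by [].
by rewrite /boundary_cost; field; rewrite !gt_eqF.
Qed.

(** Raise the barrier to [x = max b z]: the walk becomes larger, and above [x] the
    excess over [b] is the constant [phi x - phi b] plus the excess over [x]. *)
Lemma iter_op_excess_le r z :
  (iter r (K b) (exc b) z <= exc b z + boundary_cost%:E)%E.
Proof.
set x := Num.max b z.
have bx : b <= x by rewrite le_max lexx.
have zx : z <= x by rewrite le_max lexx orbT.
have excE : exc b z = (phi x - phi b)%:E.
  rewrite /exc /excess /x; have [bz|/ltW zb] := leP b z.
    by rewrite (max_idPr _)// subr_ge0 phi_nd.
  by rewrite subrr (max_idPl _)// subr_le0 phi_nd.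
rewrite excE.
have cst0 : 0 <= phi x - phi b by rewrite subr_ge0 phi_nd.
have Hx := excess_nng_nondecreasing x.
have HxD : nng_nondecreasing (fun y => exc x y + (phi x - phi b)%:E)%E.
  split=> [y|y y' yy']; first by rewrite adde_ge0 ?lee_fin//; exact: Hx.1.
  by rewrite leeD2r//; exact: Hx.2.
have := iter_op_le mu zeta M_nd r (excess_nng_nondecreasing b) HxD bx zx.
rewrite iter_opD_cst// => le_iter; rewrite addeC.
apply: (le_trans (le_iter _)); last by rewrite leeD2r// iter_op_excess_boundary.
move=> y; rewrite -EFinD lee_fin /excess.
rewrite ge_max addr_ge0 ?le_max ?lexx//=.
by rewrite -lerBlDr le_max opprB addrA subrK lexx orbT.
Qed.

(** The last value exceeds each earlier one by at most [boundary_cost], hence also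
    their average. *)
Lemma iter_op_excess_last n z : (0 < n)%N ->
  (n%:R%:E * iter n.-1 (K b) (exc b) z <=
   (sqdist_right b z / (2 * eta) +
    n%:R * (eta * (L ^+ 2 + sigma ^+ 2) / 2 + boundary_cost))%:E)%E.
Proof.
move=> n0; have Hkc := loss_pair_regret eta_gt0 L_ge0.
have Hb := excess_nng_nondecreasing b.
have e0 := boundary_cost_ge0.
have each (j : 'I_n) : (iter n.-1 (K b) (exc b) z <=
    iter j (K b) (exc b) z + boundary_cost%:E)%E.
  have -> : n.-1 = (j + (n.-1 - j))%N by rewrite subnKC// -ltnS prednK.
  rewrite iterD -iter_opD_cst//; apply: iter_op_le => //.
  - exact: iter_op_nng_nondecreasing.
  - split=> [y|y y' yy']; first by rewrite adde_ge0 ?lee_fin//; exact: Hb.1.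
    by rewrite leeD2r//; exact: Hb.2.
  - by move=> y; exact: iter_op_excess_le.
have a0 : 0 <= eta * (L ^+ 2 + sigma ^+ 2) / 2.
  by rewrite divr_ge0// mulr_ge0 ?addr_ge0 ?sqr_ge0// ltW.
have := @sum_iter_op_le _ mu zeta M M_nd b (exc b)
  (fun y : R => (1 / (2 * eta) * sqdist_right b y)%:E) _ n z Hb
  (sqdist_nng_nondecreasing b (ltW Hkc.1)) a0.
have -> : eta * (L ^+ 2 + sigma ^+ 2) / 2 =
    eta * L ^+ 2 / 2 + 1 / (2 * eta) * (eta ^+ 2 * sigma ^+ 2).
  by field; rewrite gt_eqF.
move=> /(_ (fun y => reflected_op_drift y (lexx b) Hkc)) sum_le.
have -> : (n%:R%:E * iter n.-1 (K b) (exc b) z =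
    \sum_(j < n) iter n.-1 (K b) (exc b) z)%E.
  by rewrite sumr_const card_ord mule_natl.
apply: (le_trans (lee_sum _ (fun j _ => each j))).
have -> : (\sum_(j < n) (iter j (K b) (exc b) z + boundary_cost%:E) =
    \sum_(j < n) iter j (K b) (exc b) z + (n%:R * boundary_cost)%:E)%E.
  rewrite big_split /= sumr_const card_ord; congr (_ + _)%E.
  by rewrite [RHS]EFinM mule_natl.
apply: (le_trans (leeD2r _ sum_le)); rewrite -!EFinD lee_fin.
by rewrite -addrA -mulrDr [1 / _ * sqdist_right _ _]mulrC div1r.
Qed.

End one_sided_walk.

(** * Domination of the iterates by the reflected walk *)

Section independence.
Context d (T : measurableType d) (R : realType) (P : probability T R).
Implicit Types (U V : T -> R) (mu : probability R R).

(** Independence of [U] and [V] together with the law of [V]: the case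
    [A = setT] says that [V] has law [mu]. *)
Definition independent_law U V mu : Prop :=
  forall A B, measurable A -> measurable B ->
    P (U @^-1` A `&` V @^-1` B) = (P (U @^-1` A) * mu B)%E.

Lemma integral_independent U V mu (h : R * R -> \bar R) :
  measurable_fun setT U -> measurable_fun setT V -> independent_law U V mu ->
  measurable_fun setT h -> (forall p, 0 <= h p)%E ->
  (\int[P]_t h (U t, V t) = \int[P]_t \int[mu]_w h (U t, w))%E.
Proof.
move=> mU mV indep mh h0.
have mUV : measurable_fun setT (fun t => (U t, V t)) by exact: measurable_fun_pair.
pose U' : {mfun T >-> R} := HB.pack U (isMeasurableFun.Build _ _ _ _ U mU).
pose UV : {mfun T >-> (R * R)%type} :=
  HB.pack (fun t => (U t, V t)) (isMeasurableFun.Build _ _ _ _ _ mUV).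
transitivity (\int[distribution P UV]_p h p)%E.
  by rewrite /distribution ge0_integral_pushforward.
rewrite (eq_measure_integral (distribution P U' \x mu)%E); last first.
  by move=> A mA _; apply/esym; apply: product_measure_unique.
rewrite fubini_tonelli1//.
rewrite /distribution ge0_integral_pushforward//.
  exact: measurable_fun_fubini_tonelli_F.
by move=> x _; apply: integral_ge0.
Qed.

(** Only the position [U t] after the subgradient step has to lie below the
    envelope and to be independent of the noise, so [X] need not be Markovian. *)
Lemma integral_step_le (X X' U V : T -> R) mu (zeta : R) (M : R -> R) x psi :
  measurable_fun setT X -> measurable_fun setT X' ->
  measurable_fun setT U -> measurable_fun setT V -> independent_law U V mu ->
  {homo M : y z / y <= z} -> nng_nondecreasing psi ->
  (forall t, U t <= M (X t)) ->
  (forall t, X' t <= Num.max x (U t - zeta * V t)) ->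
  (\int[P]_t psi (X' t) <= \int[P]_t reflected_op mu zeta M x psi (X t))%E.
Proof.
move=> mX mX' mU mV indep M_nd Hpsi UM X'le.
have mpsi := nng_nondecreasing_measurable Hpsi.
pose h (p : R * R) := psi (Num.max x (p.1 - zeta * p.2)).
have mh : measurable_fun setT h.
  apply: (measurableT_comp mpsi); apply: measurable_maxr => //.
  by apply: measurable_funB => //; exact: measurable_funM.
have h0 p : (0 <= h p)%E by exact: Hpsi.1.
have mUV : measurable_fun setT (fun t => (U t, V t)) by exact: measurable_fun_pair.
apply: (@le_trans _ _ (\int[P]_t h (U t, V t))%E).
  apply: ge0_le_integral => //.
  - by move=> t _; exact: Hpsi.1.
  - exact: measurableT_comp mpsi mX'.
  - exact: measurableT_comp mh mUV.
  - by move=> t _; exact: Hpsi.2.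
rewrite (integral_independent mU mV indep)//.
have HK := reflected_op_nng_nondecreasing mu zeta M_nd x Hpsi.
have Hid : nng_nondecreasing (reflected_op mu zeta id x psi).
  exact: reflected_op_nng_nondecreasing.
apply: ge0_le_integral => //.
- by move=> t _; exact: Hid.1.
- exact: (measurableT_comp (nng_nondecreasing_measurable Hid) mU).
- exact: (measurableT_comp (nng_nondecreasing_measurable HK) mX).
move=> t _; apply: ge0_le_integral => //.
- exact: (@measurable_reflected_comp _ zeta id x (U t) _ Hpsi).
- exact: (@measurable_reflected_comp _ zeta M x (X t) _ Hpsi).
move=> w _; apply: Hpsi.2.
by rewrite ge_max !le_max lexx lerD2r UM orbT.
Qed.

Lemma integral_iter_le (X U V : nat -> T -> R) mu (zeta : R) (M : R -> R) x psi n :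
  (forall k, (0 < k)%N -> measurable_fun setT (X k)) ->
  (forall k, (0 < k)%N -> measurable_fun setT (U k)) ->
  (forall k, (0 < k)%N -> measurable_fun setT (V k)) ->
  (forall k, (0 < k)%N -> independent_law (U k) (V k) mu) ->
  {homo M : y z / y <= z} -> nng_nondecreasing psi ->
  (forall k t, (0 < k)%N -> U k t <= M (X k t)) ->
  (forall k t, (0 < k)%N -> X k.+1 t <= Num.max x (U k t - zeta * V k t)) ->
  (\int[P]_t psi (X n.+1 t) <=
   \int[P]_t iter n (reflected_op mu zeta M x) psi (X 1%N t))%E.
Proof.
move=> mX mU mV indep M_nd + UM Xle; elim: n psi => // n IH psi Hpsi.
rewrite iterSr; apply: le_trans (IH _ _); last exact: reflected_op_nng_nondecreasing.
apply: (@integral_step_le (X n.+1) (X n.+2) (U n.+1) (V n.+1)) => //.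
- exact: mX.
- exact: mX.
- exact: mU.
- exact: mV.
- exact: indep.
- by move=> t; exact: UM.
- by move=> t; exact: Xle.
Qed.

End independence.

(** * Projection and one-sided gaps *)

Section convexity.
Context (R : realType) (D : set R).
Hypothesis Dconvex : convex_set (D : set (convex_lmodType R^o)).

Lemma between_conv (a b c : R) : a <= b -> b <= c ->
  exists t : {i01 R}, b = conv t (a : convex_lmodType R^o) c.
Proof.
move=> ab bc; have [ac|ca] := ltP a c; last first.
  by exists 0%:i01; rewrite conv0; apply/eqP; rewrite eq_le bc (le_trans ca).
have ac0 : 0 < c - a by rewrite subr_gt0.
have t0 : 0 <= (c - b) / (c - a) by rewrite divr_ge0 ?subr_ge0// ltW.
have t1 : (c - b) / (c - a) <= 1 by rewrite ler_pdivrMr// mul1r lerD2l lerN2.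
exists (Itv01 t0 t1); set t := (c - b) / (c - a) in t0 t1 *.
rewrite [RHS](_ : _ = t * a + (1 - t) * c)// /t.
by field; rewrite subr_eq0 gt_eqF.
Qed.

Lemma convex_set_between (a b c : R) : D a -> D c -> a <= b -> b <= c -> D b.
Proof.
move=> Da Dc ab bc; have [t ->] := between_conv ab bc.
by apply/set_mem/Dconvex; exact/mem_set.
Qed.

Variable f : R -> R.
Hypothesis fconvex : convex_function (D : set (convex_lmodType R^o)) f.

Lemma convex_between_le (a b c m : R) : D a -> D c -> a <= b -> b <= c ->
  f a <= m -> f c <= m -> f b <= m.
Proof.
move=> Da Dc ab bc fa fc; have [t ->] := between_conv ab bc.
have : f (conv t (a : convex_lmodType R^o) c) <= t%:num * f a + (1 - t%:num) * f c.
  exact: fconvex t _ _ (mem_set Da) (mem_set Dc).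
move=> /le_trans; apply.
have : 0 <= t%:num by [].
have : t%:num <= 1 by [].
nra.
Qed.

End convexity.

Section projection.
Context (R : realType) (D : set R).
Hypothesis Dclosed : closed D.
Hypothesis D_ne : D !=set0.

Lemma proj_argmin (x : R) : argmin D (fun z => `|x - z|) (proj D x).
Proof.
apply: xgetPex; have [y Dy] := D_ne; set r := `|x - y|.
have AD : (`[x - r, x + r]%classic `&` D) y.
  split=> //=; rewrite in_itv/= /r; have := ler_norm (x - y).
  by have := ler_norm (- (x - y)); rewrite normrN; lra.
have cA : compact (`[x - r, x + r]%classic `&` D).
  by apply: compact_closedI => //; exact: segment_compact.
have cf : {within `[x - r, x + r]%classic `&` D, continuous (fun z : R => `|x - z|)}.
  apply: continuous_subspaceT => z.
  by apply: cvg_norm; apply: cvgB; [exact: cvg_cst|exact: cvg_id].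
have [c /set_mem[_ Dc] c_min] := compact_EVT_min (ex_intro _ y AD) cA cf.
exists c; split => // z Dz.
have [xzr|rxz] := leP `|x - z| r.
  apply: c_min; apply/mem_set; split => //=; rewrite in_itv/=.
  by move: xzr; rewrite ler_norml; lra.
by apply: le_trans (ltW rxz); apply: c_min; exact/mem_set.
Qed.

Lemma proj_in x : D (proj D x). Proof. by have [] := proj_argmin x. Qed.

Lemma proj_id x : D x -> proj D x = x.
Proof.
move=> Dx; have [_ /(_ _ Dx)] := proj_argmin x.
by rewrite subrr normr0 normr_le0 subr_eq0 => /eqP.
Qed.

(** If the projections were in the reverse order, their minimality would put [x]
    at or above their midpoint and [y] at or below it, forcing [x = y]. *)
Lemma proj_nd : {homo proj D : x y / x <= y}.
Proof.
move=> x y xy; rewrite leNgt; apply/negP => qp.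
have [_ /(_ _ (proj_in y)) px] := proj_argmin x.
have [_ /(_ _ (proj_in x)) qy] := proj_argmin y.
suff xyE : x = y by move: qp; rewrite xyE ltxx.
have sq (u v : R) : `|u| <= `|v| -> u ^+ 2 <= v ^+ 2.
  by move=> uv; rewrite -(real_normK (num_real u)) -(real_normK (num_real v)) ler_sqr.
by apply/eqP; rewrite eq_le xy /=; have := sq _ _ px; have := sq _ _ qy; nra.
Qed.

Hypothesis D_itv : forall a b c, D a -> D c -> a <= b -> b <= c -> D b.

Lemma proj_le_of_le (z x : R) : D z -> z <= x -> proj D x <= x.
Proof.
move=> Dz zx; rewrite leNgt; apply/negP => xp.
by have := proj_id (D_itv Dz (proj_in x) zx (ltW xp)); move/eqP; rewrite gt_eqF.
Qed.

Lemma proj_ge_of_ge (z x : R) : D z -> x <= z -> x <= proj D x.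
Proof.
move=> Dz xz; rewrite leNgt; apply/negP => px.
by have := proj_id (D_itv (proj_in x) Dz (ltW px) xz); move/eqP; rewrite lt_eqF.
Qed.

Lemma proj_nonexpansive (x y : R) : x <= y -> proj D y - proj D x <= y - x.
Proof.
move=> xy; have [->|neq] := eqVneq (proj D y) (proj D x).
  by rewrite subrr subr_ge0.
have pq : proj D x < proj D y by rewrite lt_neqAle eq_sym neq proj_nd.
apply: lerB.
  rewrite leNgt; apply/negP => yq; have [py|yp] := leP (proj D x) y.
    by have := proj_id (D_itv (proj_in x) (proj_in y) py (ltW yq)) => /eqP; rewrite gt_eqF.
  have [_ /(_ _ (proj_in x))] := proj_argmin y.
  by rewrite !ltr0_norm ?subr_lt0//; lra.
rewrite leNgt; apply/negP => px; have [qx|xq] := leP (proj D y) x.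
  have [_ /(_ _ (proj_in y))] := proj_argmin x.
  rewrite gtr0_norm ?subr_gt0// ger0_norm ?subr_ge0//; lra.
by have := proj_id (D_itv (proj_in x) (proj_in y) (ltW px) (ltW xq)) => /eqP; rewrite lt_eqF.
Qed.

End projection.

(** The gap on the side [s] of the minimiser, as a function of the signed distance.
    Truncating at [0] and projecting extend it to the whole line, keeping it
    nondecreasing and Lipschitz. *)
Definition side_gap (R : realType) (D : set R) (f : R -> R) (xs s z : R) : R :=
  f (proj D (xs + s * Num.max 0 z)) - f xs.

Section one_side.
Context (R : realType) (D : set R) (f : R -> R) (L xs : R).
Hypothesis Dclosed : closed D.
Hypothesis Dconvex : convex_set (D : set (convex_lmodType R^o)).
Hypothesis fconvex : convex_function (D : set (convex_lmodType R^o)) f.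
Hypothesis flip : L.-lipschitz_D f.
Hypothesis xs_min : argmin D f xs.
Hypothesis L_ge0 : 0 <= L.

Let Dxs : D xs := xs_min.1.
Let D_ne : D !=set0 := ex_intro _ xs Dxs.
Let D_itv := @convex_set_between R D Dconvex.

Lemma lipschitz_gap_le (x y : R) : D x -> D y -> f x - f y <= L * `|x - y|.
Proof.
move=> Dx Dy; apply: le_trans (ler_norm _) _.
exact: (@flip (x, y) (conj Dx Dy)).
Qed.

Lemma nd_right_of_minimiser (y z : R) : D z -> xs <= y -> y <= z -> f y <= f z.
Proof.
move=> Dz xy yz; apply: (convex_between_le fconvex Dxs Dz xy yz) => //.
exact: xs_min.2.
Qed.

Lemma ni_left_of_minimiser (y z : R) : D z -> z <= y -> y <= xs -> f y <= f z.
Proof.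
move=> Dz zy yx; apply: (convex_between_le fconvex Dz Dxs zy yx) => //.
exact: xs_min.2.
Qed.

Variable s : R.
Hypothesis s_sign : s = 1 \/ s = -1.
Let phi := side_gap D f xs s.

Lemma side_gap_nd : {homo phi : y z / y <= z}.
Proof.
move=> y z yz; rewrite lerD2r.
have yz0 : Num.max 0 y <= Num.max 0 z by rewrite ge_max !le_max lexx yz orbT.
have z0 : 0 <= Num.max 0 z by rewrite le_max lexx.
have y0 : 0 <= Num.max 0 y by rewrite le_max lexx.
have pxs := proj_id Dclosed D_ne Dxs.
case: s_sign => ->.
  apply: nd_right_of_minimiser; first exact: proj_in.
    by rewrite -[leLHS]pxs; apply: proj_nd => //; lra.
  by apply: proj_nd => //; lra.
apply: ni_left_of_minimiser; first exact: proj_in.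
  by apply: proj_nd => //; lra.
by rewrite -[leRHS]pxs; apply: proj_nd => //; lra.
Qed.

Lemma side_gap_lip (y z : R) : y <= z -> phi z - phi y <= L * (z - y).
Proof.
move=> yz; rewrite opprB addrA subrK.
apply: (le_trans (lipschitz_gap_le (proj_in Dclosed D_ne _) (proj_in Dclosed D_ne _))).
rewrite ler_wpM2l//.
have max_lip : Num.max 0 z - Num.max 0 y <= z - y.
  by rewrite /Num.max; case: ltP => z0; case: ltP => y0; lra.
have yz0 : Num.max 0 y <= Num.max 0 z by rewrite ge_max !le_max lexx yz orbT.
apply: le_trans max_lip.
have nexp := proj_nonexpansive Dclosed D_ne D_itv.
case: s_sign => ->.
  have le12 : xs + 1 * Num.max 0 y <= xs + 1 * Num.max 0 z by lra.
  rewrite ger0_norm ?subr_ge0; last exact: proj_nd.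
  by apply: (le_trans (nexp _ _ le12)); lra.
have le21 : xs + -1 * Num.max 0 z <= xs + -1 * Num.max 0 y by lra.
rewrite ler0_norm ?subr_le0; last exact: proj_nd.
by rewrite opprB; apply: (le_trans (nexp _ _ le21)); lra.
Qed.

Lemma side_gap_npos z : z <= 0 -> phi z = 0.
Proof.
by move=> z0; rewrite /phi /side_gap (max_idPl z0) mulr0 addr0 proj_id// subrr.
Qed.

Lemma sign_involutive (x : R) : xs + s * (s * (x - xs)) = x.
Proof. by case: s_sign => ->; ring. Qed.

Lemma side_gapE x : D x -> 0 <= s * (x - xs) -> phi (s * (x - xs)) = f x - f xs.
Proof.
by move=> Dx x0; rewrite /phi /side_gap (max_idPr x0) sign_involutive proj_id.
Qed.

Lemma proj_step_le v : s * (proj D v - xs) <= Num.max 0 (s * (v - xs)).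
Proof.
have pxs := proj_id Dclosed D_ne Dxs; rewrite le_max; apply/orP.
case: s_sign => ->; rewrite ?mul1r ?mulN1r ?oppr_le0 ?lerN2 ?subr_le0 ?subr_ge0 ?lerD2r;
  have [xv|/ltW vx] := leP xs v.
- by right; exact: proj_le_of_le Dxs xv.
- by left; rewrite -[leRHS]pxs; exact: proj_nd.
- by left; rewrite -[leLHS]pxs; exact: proj_nd.
- by right; exact: proj_ge_of_ge Dxs vx.
Qed.

(** To the left of the minimiser a step of length at most [eta * L] stays below the
    floor; to its right a subgradient is nonnegative and its inequality is a
    [right_slope]. *)
Lemma subgradient_in_drift (eta x g : R) : 0 < eta -> D x ->
  subdifferential D f x g -> - L <= g <= L ->
  s * (x - eta * g - xs) <= drift phi L eta (eta * L) (s * (x - xs)).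
Proof.
move=> eta0 Dx gx gL; set y := s * (x - xs).
have sgL : - L <= s * g <= L by case: s_sign gL => ->; lra.
have -> : s * (x - eta * g - xs) = y - eta * (s * g) by rewrite /y; ring.
have [y0|y0] := leP y 0.
  apply: (@le_trans _ _ (eta * L)); last by apply: drift_ub => //; left.
  have sgL' : - (s * g) <= L by case/andP: sgL => h _; rewrite lerNl.
  by rewrite -[eta * L]add0r lerD// -mulrN ler_wpM2l// ltW.
apply: drift_ub => //; right; exists y, (s * g); split => //; split.
  apply/andP; split; last by lra.
  rewrite -(pmulr_lge0 _ y0).
  have -> : s * g * y = - (g * (xs - x)) by rewrite /y; case: s_sign => ->; ring.
  by have := gx _ Dxs; have := xs_min.2 _ Dx; lra.
move=> x' /andP[bx' x'y].
have x'0 : 0 <= x' by rewrite (le_trans _ bx')// mulr_ge0// ltW.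
set v := xs + s * x'.
have Dv : D v.
  move: (x'y); rewrite /v /y; case: s_sign => -> h.
    by apply: (D_itv Dxs Dx); lra.
  by apply: (D_itv Dx Dxs); lra.
have vE : x' = s * (v - xs) by rewrite /v; case: s_sign => ->; ring.
rewrite /y side_gapE//; last exact: ltW.
rewrite vE side_gapE//; last by rewrite -vE.
have := gx _ Dv.
have -> : g * (v - x) = - (s * g * (s * (x - xs) - s * (v - xs))).
  by case: s_sign => ->; ring.
lra.
Qed.

End one_side.

(** A point lies on one side only, so the bound [L * b] on the gap below the floor
    is counted once although both excesses appear. *)
Lemma gap_le_excess (R : realType) (D : set R) (f : R -> R) (L xs b x : R) :
  closed D -> convex_set (D : set (convex_lmodType R^o)) ->
  convex_function (D : set (convex_lmodType R^o)) f ->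
  L.-lipschitz_D f -> argmin D f xs -> 0 <= L -> 0 <= b -> D x ->
  f x - f xs <= L * b + excess (side_gap D f xs 1) b (1 * (x - xs)) +
                        excess (side_gap D f xs (-1)) b (-1 * (x - xs)).
Proof.
move=> Dcl Dcv fcv fl xs_min L0 b0 Dx.
have exc0 phi z : 0 <= excess (R := R) phi b z by rewrite /excess le_max lexx.
have one s : s = 1 \/ s = -1 -> 0 <= s * (x - xs) ->
    f x - f xs <= L * b + excess (side_gap D f xs s) b (s * (x - xs)).
  move=> sE sx; rewrite -(side_gapE Dcl xs_min sE)//.
  have := side_gap_lip Dcl Dcv fl xs_min L0 sE b0.
  rewrite (@side_gap_npos _ _ _ _ Dcl xs_min s 0)// !subr0 => bL.
  have : side_gap D f xs s (s * (x - xs)) - side_gap D f xs s b <=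
    excess (side_gap D f xs s) b (s * (x - xs)) by rewrite /excess le_max lexx orbT.
  lra.
have [xx|/ltW xx] := leP xs x.
  have h : 0 <= 1 * (x - xs) by lra.
  by have := one 1 (or_introl erefl) h;
     have := exc0 (side_gap D f xs (-1)) (-1 * (x - xs)); lra.
have h : 0 <= -1 * (x - xs) by lra.
by have := one (-1) (or_intror erefl) h;
   have := exc0 (side_gap D f xs 1) (1 * (x - xs)); lra.
Qed.

(** * Adaptedness of the iterates *)

Section adapted.
Context d (T : measurableType d) (R : realType) (P : probability T R).

Lemma filtration_measurable (X1 : T -> R) (W : nat -> {RV P >-> R}) k :
  measurable_fun setT X1 -> filtration X1 W k `<=` @measurable _ T.
Proof.
move=> mX1; apply: smallest_sub; first exact: sigma_algebra_measurable.
move=> A [|[i _]] [B mB <-]; first exact: mX1.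
exact: measurable_funPT.
Qed.

Lemma filtration_subS (X1 : T -> R) (W : nat -> T -> R) k :
  filtration X1 W k `<=` filtration X1 W k.+1.
Proof.
apply: sub_sigma_algebra2 => A [XA|[i /andP[i0 ik] WA]]; first by left.
by right; exists i => //=; rewrite i0 ltnS ltnW.
Qed.

Lemma measurable_wrt_fun (G : set (set T)) (g : T -> R) :
  measurable_wrt <<s G >> g <->
  measurable_fun setT (g : g_sigma_algebraType G -> R).
Proof.
split=> [mg _ B mB|mg B mB]; first by rewrite setTI; exact: mg.
by rewrite -[X in _ X]setTI; exact: mg.
Qed.

Lemma drifted_measurable_wrt (X1 : T -> R) (W : nat -> T -> R) k (x g : T -> R)
    (eta : R) :
  measurable_wrt (filtration X1 W k) x -> measurable_wrt (filtration X1 W k) g ->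
  measurable_wrt (filtration X1 W k) (fun t => x t - eta * g t).
Proof.
move=> /measurable_wrt_fun mx /measurable_wrt_fun mg; apply/measurable_wrt_fun.
by apply: measurable_funB => //; exact: measurable_funM.
Qed.

Lemma iterate_adapted (D : set R) (f : R -> R) (L eta : R) (X G : nat -> T -> R)
    (W : nat -> {RV P >-> R}) k :
  closed D -> subgradient_method D f L eta X G W -> (0 < k)%N ->
  measurable_wrt (filtration (X 1%N) W k) (X k).
Proof.
move=> Dcl method; elim: k => // -[_ _|k IH _].
  move=> B mB; apply: sub_sigma_algebra; left.
  by exists B => //; rewrite setTI.
have /measurable_wrt_fun mX : measurable_wrt (filtration (X 1%N) W k.+2) (X k.+1).
  by move=> B mB; apply: filtration_subS; exact: IH.
have /measurable_wrt_fun mG : measurable_wrt (filtration (X 1%N) W k.+2) (G k.+1).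
  by move=> B mB; apply: filtration_subS; exact: (subgrad_measurable method).
have /measurable_wrt_fun mW : measurable_wrt (filtration (X 1%N) W k.+2) (W k.+1).
  move=> B mB; apply: sub_sigma_algebra; right; exists k.+1; first by rewrite /= ltnSn.
  by exists B => //; rewrite setTI.
have -> : X k.+2 = proj D \o (fun t => X k.+1 t - eta * (G k.+1 t + W k.+1 t)).
  by apply/funext => t; rewrite (iterate_step method).
apply/measurable_wrt_fun; apply: measurableT_comp.
  apply: nondecreasing_measurable => //; apply: proj_nd => //.
  have [t _] : exists t : T, True by exists point.
  by exists (X 1%N t); exact: (init_in method).
apply: measurable_funB => //; apply: measurable_funM => //.
exact: measurable_funD.
Qed.

Lemma iterate_in (D : set R) (f : R -> R) (L eta : R) (X G : nat -> T -> R)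
    (W : nat -> {RV P >-> R}) k t :
  closed D -> subgradient_method D f L eta X G W -> (0 < k)%N -> D (X k t).
Proof.
move=> Dcl method; case: k => // -[_|k _]; first exact: (init_in method).
rewrite (iterate_step method)//; apply: proj_in => //.
by exists (X 1%N t); exact: (init_in method).
Qed.

Lemma cond_prob_cst (G : set (set T)) (E B : set T) (Y : T -> R) (c : \bar R) :
  is_cond_prob P <<s G >> E Y -> {ae P, forall t, (Y t)%:E = c} ->
  <<s G >> B -> measurable B -> P (E `&` B) = (c * P B)%E.
Proof.
move=> [_ iY YE] Yc GB mB; rewrite -YE// -integral_cst//.
apply: ae_eq_integral => //.
  by apply: (measurable_funS _ (@subsetT _ B)) => //; exact: measurable_int iY.
by apply: filterS Yc => t /= Yt _.
Qed.

End adapted.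

(** * The last iterate, for a fixed minimiser *)

Lemma min_valueE (R : realType) (D : set R) (f : R -> R) (xs : R) :
  argmin D f xs -> min_value D f = f xs.
Proof.
move=> [Dxs xs_min]; apply/eqP; rewrite eq_le; apply/andP; split.
  apply: ge_inf; last by exists xs.
  by exists (f xs) => _ [y Dy <-]; exact: xs_min.
by apply: lb_le_inf; [exists (f xs); exists xs|move=> _ [y Dy <-]; exact: xs_min].
Qed.

Lemma gap_sum (R : realType) (D : set R) (f : R -> R) (xs x : R) :
  closed D -> argmin D f xs -> D x ->
  f x - f xs = side_gap D f xs 1 (1 * (x - xs)) +
               side_gap D f xs (-1) (-1 * (x - xs)).
Proof.
move=> Dcl xs_min Dx; have [xx|/ltW xx] := leP xs x.
  rewrite (side_gapE Dcl xs_min (or_introl erefl))//; last by lra.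
  by rewrite (side_gap_npos Dcl xs_min) ?addr0//; lra.
rewrite (side_gapE Dcl xs_min (or_intror erefl))//; last by lra.
by rewrite (side_gap_npos Dcl xs_min) ?add0r//; lra.
Qed.

Section last_iterate.
Context (R : realType) (d : measure_display) (T : measurableType d)
  (P : probability T R) (D : set R) (f : R -> R) (L sigma eta x1 xs : R)
  (X G : nat -> T -> R) (W : nat -> {RV P >-> R}) (mu : probability R R).
Hypothesis Dclosed : closed D.
Hypothesis Dconvex : convex_set (D : set (convex_lmodType R^o)).
Hypothesis fconvex : convex_function (D : set (convex_lmodType R^o)) f.
Hypothesis flip : L.-lipschitz_D f.
Hypothesis xs_min : argmin D f xs.
Hypothesis L_ge0 : 0 <= L.
Hypothesis sigma_gt0 : 0 < sigma.
Hypothesis eta_gt0 : 0 < eta.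
Hypothesis X1E : forall t, X 1%N t = x1.
Hypothesis method : subgradient_method D f L eta X G W.
Hypothesis mu_centered : (\int[mu]_w w%:E = 0)%E.
Hypothesis mu_moment2 : (\int[mu]_w (w ^+ 2)%:E <= (sigma ^+ 2)%:E)%E.
Hypothesis noise_indep : forall k U, (0 < k)%N ->
  measurable_wrt (filtration (X 1%N) W k) U -> independent_law P U (W k) mu.

Let b := eta * L.
Let b_ge0 : 0 <= b := mulr_ge0 (ltW eta_gt0) L_ge0.
Let phi (s : R) := side_gap D f xs s.
Let exc (s z : R) : \bar R := (excess (phi s) b z)%:E.
Let K (s : R) := reflected_op mu (s * eta) (drift (phi s) L eta b) b.

Let measurable_X k : (0 < k)%N -> measurable_fun setT (X k).
Proof.
move=> k0 _ B mB; rewrite setTI.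
apply: (filtration_measurable (k := k) (init_measurable method)).
exact: (iterate_adapted Dclosed method k0).
Qed.

Lemma integral_excess_le (s : R) n : s = 1 \/ s = -1 ->
  (\int[P]_t exc s (s * (X n.+1 t - xs))%R <= iter n (K s) (exc s) (s * (x1 - xs))%R)%E.
Proof.
move=> sE.
have phi_nd := side_gap_nd Dclosed fconvex xs_min sE.
have wU k : (0 < k)%N -> measurable_wrt (filtration (X 1%N) W k)
    (fun t => s * (X k t - eta * G k t - xs)).
  move=> k0; apply/measurable_wrt_fun.
  apply: measurable_funM => //; apply: measurable_funB => //.
  apply/measurable_wrt_fun; apply: drifted_measurable_wrt.
    exact: (iterate_adapted Dclosed method).
  exact: (subgrad_measurable method).
have -> : iter n (K s) (exc s) (s * (x1 - xs)) =
    (\int[P]_t iter n (K s) (exc s) (s * (X 1%N t - xs))%R)%E.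
  rewrite -[LHS](integral_probability_cst P).
  by apply: eq_integral => t _; rewrite X1E.
apply: (@integral_iter_le _ _ _ P (fun k t => s * (X k t - xs))
  (fun k t => s * (X k t - eta * G k t - xs)) W mu (s * eta)
  (drift (phi s) L eta b) b (exc s) n).
- move=> k k0; apply: measurable_funM => //; apply: measurable_funB => //.
  exact: measurable_X.
- move=> k k0 _ B mB; rewrite setTI.
  apply: (filtration_measurable (k := k) (init_measurable method)).
  exact: wU.
- by move=> k _.
- by move=> k k0; apply: noise_indep => //; exact: wU.
- exact: drift_nd.
- exact: excess_nng_nondecreasing.
- move=> k t k0; have [gX gL] := subgrad_in method t k0.
  apply: subgradient_in_drift => //.
  exact: iterate_in method k0.
- move=> k t k0; rewrite (iterate_step method)//.
  apply: (le_trans (proj_step_le Dclosed Dconvex xs_min sE _)).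
  rewrite ge_max !le_max b_ge0 /=; apply/orP; right.
by rewrite le_eqVlt; apply/orP; left; apply/eqP; ring.
Qed.

Lemma last_iterate_bound n : (0 < n)%N ->
  (\int[P]_t (f (X n t) - f xs)%:E <=
   ((x1 - xs) ^+ 2 / (2 * eta * n%:R) +
    ((L + sigma) ^+ 2 + (L ^+ 2 + sigma ^+ 2) / 2) * eta)%:E)%E.
Proof.
case: n => // n _.
have sg1 : 1 = 1 :> R \/ 1 = -1 :> R by left.
have sgN1 : -1 = 1 :> R \/ -1 = -1 :> R by right.
have phi_nd (s : R) : s = 1 \/ s = -1 -> {homo phi s : y z / y <= z}.
  exact: side_gap_nd.
have zeta2 (s : R) : s = 1 \/ s = -1 -> (s * eta) ^+ 2 = eta ^+ 2.
  by case=> ->; ring.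
have mexc (s : R) : s = 1 \/ s = -1 ->
    measurable_fun setT (fun t => exc s (s * (X n.+1 t - xs))%R).
  move=> sE.
  apply: (measurableT_comp (nng_nondecreasing_measurable
            (excess_nng_nondecreasing (phi_nd _ sE) b))).
  apply: measurable_funM => //; apply: measurable_funB => //; exact: measurable_X.
have exc0 s z : (0 <= exc s z)%E by rewrite lee_fin /excess le_max lexx.
have mphi (s : R) : s = 1 \/ s = -1 ->
    measurable_fun setT (fun t => phi s (s * (X n.+1 t - xs))).
  move=> sE; apply: (measurableT_comp (nondecreasing_measurable measurableT (phi_nd _ sE))).
  apply: measurable_funM => //; apply: measurable_funB => //; exact: measurable_X.
have DX t : D (X n.+1 t) by exact: iterate_in method _.
have split_le : (\int[P]_t (f (X n.+1 t) - f xs)%:E <=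
    (L * b)%:E + \int[P]_t exc 1%R (1 * (X n.+1 t - xs))%R +
    \int[P]_t exc (-1)%R (-1 * (X n.+1 t - xs))%R)%E.
  rewrite -(integral_probability_cst P (L * b)%:E) -!ge0_integralD//=.
  - apply: ge0_le_integral => //.
    + by move=> t _; rewrite lee_fin subr_ge0; exact: xs_min.2.
    + apply/measurable_EFinP.
      under eq_fun do rewrite (gap_sum Dclosed xs_min (DX _)).
      by apply: measurable_funD; exact: mphi.
    + apply: emeasurable_funD; last exact: mexc.
      by apply: emeasurable_funD => //; exact: mexc.
    + move=> t _; rewrite /exc -!EFinD lee_fin.
      exact: (gap_le_excess Dclosed Dconvex fconvex flip xs_min L_ge0 b_ge0 (DX t)).
  - by move=> t _; rewrite adde_ge0// lee_fin mulr_ge0.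
  - by apply: emeasurable_funD => //; exact: mexc.
  - exact: mexc.
  - by move=> _ _; rewrite lee_fin mulr_ge0.
  - exact: mexc.
set e := boundary_cost sigma L eta.
have far (s : R) : s = 1 \/ s = -1 -> 0 <= s * (x1 - xs) ->
    (\int[P]_t exc s (s * (X n.+1 t - xs))%R <=
     ((x1 - xs) ^+ 2 / (2 * eta * n.+1%:R) +
       (eta * (L ^+ 2 + sigma ^+ 2) / 2 + e))%:E)%E.
  move=> sE z0; apply: (le_trans (integral_excess_le n sE)).
  have n0 : 0 < n.+1%:R :> R by [].
  have /= := @iter_op_excess_last _ mu sigma sigma_gt0 mu_centered mu_moment2 (phi s)
    L eta b (s * eta) eta_gt0 L_ge0 (zeta2 _ sE) (phi_nd _ sE)
    (side_gap_lip Dclosed Dconvex flip xs_min L_ge0 sE) n.+1 (s * (x1 - xs)) isT.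
  rewrite -lee_pdivlMl// => /le_trans; apply; rewrite -EFinM lee_fin mulrDr mulKf ?gt_eqF//.
  rewrite lerD2r [2 * eta * _]mulrC [in leRHS]invfM [leRHS]mulrCA.
  rewrite ler_wpM2l ?invr_ge0// ler_wpM2r ?invr_ge0 ?mulr_ge0 ?(ltW eta_gt0)//.
  have -> : (x1 - xs) ^+ 2 = (s * (x1 - xs)) ^+ 2 by case: sE => ->; ring.
  rewrite /sqdist_right ler_sqr ?nnegrE//; last by rewrite le_max lexx.
  by rewrite ge_max z0 gerBl.
(* On the side away from [x1] the walk starts below the floor, with zero excess. *)
have near (s : R) : s = 1 \/ s = -1 -> s * (x1 - xs) <= 0 ->
    (\int[P]_t exc s (s * (X n.+1 t - xs))%R <= e%:E)%E.
  move=> sE z0; apply: (le_trans (integral_excess_le n sE)).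
  have := @iter_op_excess_le _ mu sigma sigma_gt0 mu_centered mu_moment2 (phi s)
    L eta b (s * eta) eta_gt0 L_ge0 (zeta2 _ sE) (phi_nd _ sE)
    (side_gap_lip Dclosed Dconvex flip xs_min L_ge0 sE) n (s * (x1 - xs)).
  rewrite /excess (max_idPl _) ?add0e// subr_le0.
  by apply: (phi_nd _ sE); exact: le_trans z0 b_ge0.
have total : (x1 - xs) ^+ 2 / (2 * eta * n.+1%:R) +
    ((L + sigma) ^+ 2 + (L ^+ 2 + sigma ^+ 2) / 2) * eta =
    L * b + ((x1 - xs) ^+ 2 / (2 * eta * n.+1%:R) +
       (eta * (L ^+ 2 + sigma ^+ 2) / 2 + e)) + e.
  by rewrite /b /e /boundary_cost; field; rewrite nat1r pnatr_eq0 (gt_eqF eta_gt0).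
apply: (le_trans split_le); rewrite total.
have [x1s|/ltW x1s] := leP xs x1.
  rewrite EFinD leeD//; last by apply: near => //; lra.
  by rewrite EFinD leeD2l//; apply: far => //; lra.
rewrite [X in (_ <= X%:E)%E]addrAC EFinD leeD//; last by apply: far => //; lra.
by rewrite EFinD leeD2l//; apply: near => //; lra.
Qed.

End last_iterate.

(** * Law of the noise and conclusion *)

(** Passes from one minimiser to the infimum of the distances without a nearest
    minimiser. *)
Lemma le_dist_set_sqr (R : realType) (x a c : R) (E : \bar R) (S : set R) :
  S !=set0 -> 0 < a -> (0 <= E)%E ->
  (forall z, S z -> (E <= ((x - z) ^+ 2 / a + c)%:E)%E) ->
  (E <= (dist_set x S ^+ 2 / a + c)%:E)%E.
Proof.
move=> [z0 Sz0] a0 E0 bound.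
case: E E0 bound => [e|_ /(_ _ Sz0)|//]; last by rewrite leye_eq.
move=> _ bound; rewrite lee_fin -lerBlDr ler_pdivlMr//.
set r := (e - c) * a; have [r0|r0] := leP r 0.
  by rewrite (le_trans r0)// sqr_ge0.
rewrite -[leLHS]sqr_sqrtr ?(ltW r0)// ler_sqr ?nnegrE ?sqrtr_ge0//; last first.
  by apply: lb_le_inf; [exists `|x - z0|; exists z0|move=> _ [z _ <-]].
apply: lb_le_inf; first by exists `|x - z0|; exists z0.
move=> _ [z Sz <-]; rewrite -sqrtr_sqr ler_wsqrtr// /r -ler_pdivlMr// lerBlDr.
by have := bound _ Sz; rewrite lee_fin.
Qed.

Section oracle.
Context d (T : measurableType d) (R : realType) (P : probability T R)
  (D : set R) (f : R -> R) (L eta sigma : R) (X G : nat -> T -> R)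
  (W : nat -> {RV P >-> R}) (Q : nat -> R.-pker R ~> R).
Hypothesis Dclosed : closed D.
Hypothesis method : subgradient_method D f L eta X G W.
Hypothesis oracle : kernel_oracle D sigma X W Q.

Lemma common_noise_law x : D x -> time_homogeneous D Q -> state_independent D Q ->
  exists mu : probability R R, forall k y A, (0 < k)%N -> D y -> measurable A ->
    Q k y A = mu A.
Proof.
move=> Dx [Q0 Q0E] /(_ 1%N isT)[mu muE]; exists mu => k y A k0 Dy mA.
by rewrite Q0E// -(Q0E 1%N)// muE.
Qed.

(** The conditional law is constant because the kernels do not depend on the
    state, and a constant conditional law means independence of the past. *)
Lemma oracle_independent (mu : probability R R) k U : (0 < k)%N ->
  (forall y A, D y -> measurable A -> Q k y A = mu A) ->
  measurable_wrt (filtration (X 1%N) W k) U -> independent_law P U (W k) mu.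
Proof.
move=> k0 QE FU A B mA mB.
have [Y YB YQ] := oracle_cond_law oracle k0 mB.
rewrite setIC muleC; apply: (cond_prob_cst YB).
- apply: filterS YQ => t ->; apply: QE => //; exact: iterate_in method k0.
- exact: FU.
- exact: filtration_measurable (init_measurable method) _ (FU _ mA).
Qed.

End oracle.

Unset Implicit Arguments.

Theorem theorem2 (R : realType) (d : measure_display) (T : measurableType d)
    (P : probability T R)
    (D : set R) (f : R -> R) (L sigma eta x1 : R)
    (X G : nat -> T -> R) (W : nat -> {RV P >-> R})
    (Q : nat -> R.-pker R ~> R)
    (Dclosed : closed D)
    (Dconvex : convex_set (D : set (convex_lmodType R^o)))
    (fconvex : convex_function (D : set (convex_lmodType R^o)) f)
    (flip : L.-lipschitz_D f)
    (fmin : argmin D f !=set0)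
    (sigma_gt0 : 0 < sigma)
    (eta_gt0 : 0 < eta)
    (Dx1 : D x1)
    (X1E : forall w, X 1%N w = x1)
    (method : subgradient_method D f L eta X G W)
    (oracle : kernel_oracle D sigma X W Q)
    (homogeneous : time_homogeneous D Q)
    (independent : state_independent D Q)
    (n : nat) (n_ge2 : (2 <= n)%N) :
  let Delta (x : R) := f x - min_value D f in
  let dist := dist_set x1 (argmin D f) in
  let C := (L + sigma) ^+ 2 + (L ^+ 2 + sigma ^+ 2) / 2 in
  ('E_P[fun w => Delta (X n w)] <=
     (dist ^+ 2 / (2 * eta * n%:R) + C * eta)%:E)%E /\
  (forall c c_low c_up : R,
     0 < c_low -> c_low <= c -> c <= c_up -> eta = c / Num.sqrt n%:R ->
     ('E_P[fun w => Delta (X n w)] <=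
        ((dist ^+ 2 / (2 * c_low) + C * c_up) * (1 / Num.sqrt n%:R))%:E)%E).
Proof.
move=> Delta dist C.
have L_ge0 : 0 <= L.
  have [_] := subgrad_in method point (isT : (0 < 1)%N).
  by rewrite /= in_itv/=; lra.
have [mu muE] := common_noise_law Dx1 homogeneous independent.
have QmuE (g : R -> \bar R) : (\int[Q 1%N x1]_w g w = \int[mu]_w g w)%E.
  by apply: eq_measure_integral => A mA _; exact: muE.
have mu_centered : (\int[mu]_w w%:E = 0)%E.
  by rewrite -QmuE; exact: (oracle_centered oracle).
have mu_moment2 : (\int[mu]_w (w ^+ 2)%:E <= (sigma ^+ 2)%:E)%E.
  by rewrite -QmuE; exact: (oracle_second_moment oracle).
have n0 : (0 < n)%N by exact: leq_trans n_ge2.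
have first_bound : ('E_P[fun w => Delta (X n w)] <=
    (dist ^+ 2 / (2 * eta * n%:R) + C * eta)%:E)%E.
  rewrite unlock; apply: le_dist_set_sqr => //.
  - by rewrite !mulr_gt0// ltr0n.
  - apply: integral_ge0 => t _; rewrite lee_fin subr_ge0.
    have [xs xs_min] := fmin; rewrite (min_valueE xs_min).
    by apply: xs_min.2; exact: iterate_in method n0.
  - move=> z zmin; rewrite /Delta (min_valueE zmin).
    apply: (last_iterate_bound Dclosed Dconvex fconvex flip zmin L_ge0 sigma_gt0
      eta_gt0 X1E method mu_centered mu_moment2 _ n0) => k U k0.
    by apply: (oracle_independent Dclosed method oracle k0) => y A; exact: muE.
split=> // c c_low c_up cl0 clc ccu etaE.
apply: (le_trans first_bound); rewrite lee_fin.
set r := Num.sqrt n%:R in etaE *.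
have r0 : 0 < r by rewrite sqrtr_gt0 ltr0n.
have c0 : 0 < c by exact: lt_le_trans clc.
have -> : n%:R = r ^+ 2 by rewrite sqr_sqrtr.
have -> : dist ^+ 2 / (2 * eta * r ^+ 2) + C * eta =
    (dist ^+ 2 / (2 * c) + C * c) * (1 / r).
  by rewrite etaE; field; rewrite !gt_eqF.
have C0 : 0 <= C by rewrite addr_ge0 ?divr_ge0 ?addr_ge0 ?sqr_ge0.
rewrite ler_wpM2r ?divr_ge0 ?(ltW r0)// lerD ?ler_wpM2l ?sqr_ge0//.
by rewrite lef_pV2 ?posrE ?mulr_gt0// ler_wpM2l.
Qed.
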